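(* Let $S\in\mathcal H(d)$ and $\mu=(\mu_i)_{i\in\mathbb I_d}\in(\mathbb R^d)^\downarrow$. Assume that $N$ is a strictly convex unitarily invariant norm on $\mathcal M_d(\mathbb C)$ and that $G_0\in\mathcal O_\mu$ is a local minimizer of $\Phi:\mathcal O_\mu\to\mathbb R_{\ge 0}$, $\Phi(G)=N(S-G)$, on $\mathcal O_\mu$. Then there exists an orthonormal basis $\{v_i\}_{i\in\mathbb I_d}$ of $\mathbb C^d$ such that $$S=\sum_{i\in\mathbb I_d}\lambda_i\ v_i\otimes v_i\quad\text{and}\quad G_0=\sum_{i\in\mathbb I_d}\mu_i\ v_i\otimes v_i,$$ where $(\lambda_i)_{i\in\mathbb I_d}=\lambda(S)\in(\mathbb R^d)^\downarrow$. In particular, $\lambda(S-G_0)=(\lambda(S)-\lambda(G_0))^\downarrow$, so $G_0$ is also a global minimizer of $\Phi$ on $\mathcal O_\mu$.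
   Context: $\mathbb I_d=\{1,\dots,d\}$. $\mathcal M_d(\mathbb C)$ is the algebra of complex $d\times d$ matrices, $\mathcal H(d)$ its real subspace of selfadjoint matrices, $\mathcal U(d)$ the group of unitary matrices. For $x\in\mathbb R^d$, $x^\downarrow$ is the vector obtained by rearranging the entries of $x$ in non-increasing order, and $(\mathbb R^d)^\downarrow=\{x^\downarrow:x\in\mathbb R^d\}$. $D_x$ is the diagonal matrix with main diagonal $x$. For $A\in\mathcal H(d)$, $\lambda(A)=(\lambda_i(A))_{i\in\mathbb I_d}\in(\mathbb R^d)^\downarrow$ is the vector of eigenvalues of $A$ counting multiplicities, in non-increasing order. For $x,y\in\mathbb C^d$, $x\otimes y$ is the matrix given by $(x\otimes y)z=\langle z,y\rangle x$. A norm $N$ on $\mathcal M_d(\mathbb C)$ is unitarily invariant if $N(UAV)=N(A)$ for all $A\in\mathcal M_d(\mathbb C)$ and $U,V\in\mathcal U(d)$. The set $\mathcal O_\mu=\{G\in\mathcal H(d):\lambda(G)=\mu\}=\{U^*D_\mu U:U\in\mathcal U(d)\}$ is endowed with the metric induced by the operator (spectral) norm. *)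

(* Defs.v *)
From mathcomp Require Export all_boot all_order all_algebra.
From mathcomp Require Export complex.
From mathcomp Require Export boolp classical_sets reals.

Set Implicit Arguments.
Unset Strict Implicit.
Unset Printing Implicit Defensive.

Import Order.TTheory GRing.Theory Num.Theory.
Import ComplexField.Normc.

#[global] Open Scope ring_scope.
#[global] Open Scope complex_scope.
#[global] Open Scope sesquilinear_scope.
#[global] Open Scope classical_set_scope.

Section Defs.
Variables (R : realType) (d : nat).

Implicit Types (A B G U V : 'M[R[i]]_d) (x y z : 'cV[R[i]]_d)
  (a mu : 'rV[R]_d) (N : 'M[R[i]]_d -> R).

(* Vectors of C^d are columns; the inner product is linear in its first slot. *)
Definition inner x y : R[i] := \sum_(i < d) x i 0 * Num.conj (y i 0).

Definition rank1 x y : 'M[R[i]]_d := x *m y ^t*.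

Lemma rank1E x y z : rank1 x y *m z = inner z y *: x.
Proof.
apply/matrixP => i j; rewrite (ord1 j) /rank1 -mulmxA !mxE big_ord1 mulrC.
by rewrite !mxE; congr (_ * _); apply: eq_bigr => k _; rewrite !mxE mulrC.
Qed.

Definition orthonormal_basis (v : 'I_d -> 'cV[R[i]]_d) : Prop :=
  (forall i j, inner (v i) (v j) = (i == j)%:R) /\
  basis_of fullv [seq v i | i <- enum 'I_d].

Definition decreasing_row (s : seq R) : 'rV[R]_d :=
  \row_(i < d) (sort >=%R s)`_i.

Definition rearr a : 'rV[R]_d := decreasing_row [seq a 0 i | i <- enum 'I_d].

Definition decreasing_vectors : set 'rV[R]_d := range rearr.

(* The roots of the characteristic polynomial, with multiplicity. *)
Definition spectrum A : seq R[i] :=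
  sval (closed_field_poly_normal (char_poly A)).

(* Meant for selfadjoint [A], whose eigenvalues are real. *)
Definition lambda A : 'rV[R]_d :=
  decreasing_row [seq complex.Re c | c <- spectrum A].

Definition l2norm x : R := Num.sqrt (\sum_(i < d) normc (x i 0) ^+ 2).

Definition spectral_norm A : R :=
  sup [set l2norm (A *m x) | x in [set x | l2norm x = 1]].

Record is_norm N : Prop := IsNorm {
  norm_ge0 : forall A, 0 <= N A;
  norm_eq0 : forall A, N A = 0 -> A = 0;
  normZ : forall (c : R[i]) A, N (c *: A) = normc c * N A;
  norm_triangle : forall A B, N (A + B) <= N A + N B }.

Definition unitarily_invariant N : Prop :=
  forall A U V, U \is unitarymx -> V \is unitarymx -> N (U *m A *m V) = N A.

Definition strictly_convex N : Prop :=
  forall A B (t : R), N A = 1 -> N B = 1 -> A <> B -> 0 < t < 1 ->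
    N (t%:C *: A + (1 - t)%:C *: B) < 1.

Definition orbit_of mu : set 'M[R[i]]_d :=
  [set G | G \is hermsymmx /\ lambda G = mu].

Definition local_minimizer (O : set 'M[R[i]]_d) (Phi : 'M[R[i]]_d -> R) G0 :
    Prop :=
  O G0 /\ exists2 e : R, 0 < e &
    forall G, O G -> spectral_norm (G - G0) < e -> Phi G0 <= Phi G.

Definition global_minimizer (O : set 'M[R[i]]_d) (Phi : 'M[R[i]]_d -> R) G0 :
    Prop :=
  O G0 /\ forall G, O G -> Phi G0 <= Phi G.

End Defs.

(* Main.v *)
Require Import Defs.
From mathcomp Require Import ring lra.
From mathcomp Require functions topology normedtype realfun derive.

Set Implicit Arguments.
Unset Strict Implicit.
Unset Printing Implicit Defensive.

Import Order.TTheory GRing.Theory Num.Theory.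
Import ComplexField ComplexField.Normc.

(** Put [A = S - G0].  Strict convexity enters twice in the same way: a
    convex combination of two distinct unitary conjugates of [A], with nonzero
    weights, is strictly shorter than [A], because both have the norm of [A].

    Commutation.  For a skew-adjoint [X] the Cayley transform of [t/2 X] moves
    [G0] inside its orbit to [G0 + t (X G0 - G0 X) + O(t^2)].  As [N] is convex,
    this yields [N A <= N (A - (X G0 - G0 X))] for every such [X], without any
    differentiability of [N] ([first_order_condition]).  The commutators
    [X G0 - G0 X] fill all the off-diagonal blocks with respect to the
    eigenspaces of [G0], so [X] can be chosen to erase those entries of [A] that
    couple one eigenspace with its complement; what is left is the average of
    [A] and its conjugate by a diagonal matrix of signs.  If [A] did not commute
    with [G0], some coupling would be nonzero and the average would be shorter
    than [A] ([hermitian_commute]).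

    Alignment.  In a common eigenbasis [S] and [G0] are diagonal, with entries
    [s] and [g].  Suppose that [s i > s j] and [g i < g j].  Conjugating [G0] by
    a reflection of the plane of [e_i] and [e_j] close to [diag(1, -1)] changes
    only a 2 x 2 block of [A] and brings the two eigenvalues of that block strictly closer to each
    other, keeping their sum.  The real symmetric 2 x 2 matrices with given
    eigenvalues form a circle, whose points are conjugate under reflections; the
    new block lies inside the circle of the old one, hence on a chord between
    two of its points, and the norm drops ([norm_disk_lt],
    [aligned_eigenvalues]).  So the two lists of eigenvalues can be sorted
    simultaneously, which gives the basis ([local_minimizer_structure]).

    Global minimality.  The orbit is the continuous image of the compact unitary
    group, so a global minimizer exists ([orbit_minimizer]).  It is in
    particular a local one and has the structure just found; this structure
    determines the value [N (D_(lambda S - mu))], so every local minimizer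
    attains the global minimum.  Compactness takes the place of Lidskii's
    inequality here. *)

(** * Adjoints, diagonalisation and ordered eigenvalues *)

Section Adjoint.
Variable C : numClosedFieldType.

Lemma adjM m n p (A : 'M[C]_(m, n)) (B : 'M[C]_(n, p)) :
  (A *m B)^t* = B^t* *m A^t*.
Proof. by rewrite trmx_mul map_mxM. Qed.

Lemma adjD m n (A B : 'M[C]_(m, n)) : (A + B)^t* = A^t* + B^t*.
Proof. by rewrite linearD map_mxD. Qed.

Lemma adjB m n (A B : 'M[C]_(m, n)) : (A - B)^t* = A^t* - B^t*.
Proof. by rewrite linearB map_mxB. Qed.

Lemma adjZ m n c (A : 'M[C]_(m, n)) : (c *: A)^t* = c^* *: A^t*.
Proof. by rewrite linearZ map_mxZ. Qed.

Lemma adj1 n : (1%:M : 'M[C]_n)^t* = 1%:M.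
Proof. by rewrite trmx1 map_mx1. Qed.

Lemma hermsymmxP n (A : 'M[C]_n) : reflect (A^t* = A) (A \is hermsymmx).
Proof.
by apply: (iffP (is_hermitianmxP _ _ _)); rewrite expr0 scale1r => /esym.
Qed.

Lemma unitarymxPr n (U : 'M[C]_n) : U \is unitarymx -> U^t* *m U = 1%:M.
Proof. by move=> /unitarymxP /mulmx1C. Qed.

Lemma adj_unitary n (U : 'M[C]_n) : U \is unitarymx -> U^t* \is unitarymx.
Proof. by rewrite trmxC_unitary. Qed.

Lemma hermsymmx_conj m n (W : 'M[C]_(m, n)) A :
  A \is hermsymmx -> W *m A *m W^t* \is hermsymmx.
Proof.
by move=> /hermsymmxP hA; apply/hermsymmxP; rewrite !adjM trmxCK hA mulmxA.
Qed.

Lemma hermsymmxB n (A B : 'M[C]_n) :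
  A \is hermsymmx -> B \is hermsymmx -> A - B \is hermsymmx.
Proof.
by move=> /hermsymmxP hA /hermsymmxP hB; apply/hermsymmxP; rewrite adjB hA hB.
Qed.

(** Two unitary diagonalisations of the same diagonal are conjugate: this is why the
    orbit is a single conjugacy class. *)
Lemma unitary_transport n (V W D : 'M[C]_n) : W \is unitarymx ->
  V *m D *m V^t* = (V *m W^t*) *m (W *m D *m W^t*) *m (V *m W^t*)^t*.
Proof. by move=> uW; rewrite adjM trmxCK !mulmxA !mulmxKtV. Qed.

Lemma unitary_conj_comp n (U W D : 'M[C]_n) :
  U *m (W *m D *m W^t*) *m U^t* = (U *m W) *m D *m (U *m W)^t*.
Proof. by rewrite adjM !mulmxA. Qed.

Lemma unitary_conj_mul n (W A B : 'M[C]_n) : W \is unitarymx ->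
  (W *m A *m W^t*) *m (W *m B *m W^t*) = W *m (A *m B) *m W^t*.
Proof. by move=> uW; rewrite !mulmxA mulmxKtV. Qed.

Lemma normal_diag n (A : 'M[C]_n) : A *m A^t* = A^t* *m A ->
  exists2 W : 'M[C]_n, W \is unitarymx &
    exists z : 'rV[C]_n, A = W *m diag_mx z *m W^t*.
Proof.
move=> /normalmxP /orthomx_spectral_subproof [[P z] /= uP ->].
exists (P^t*); first by rewrite trmxC_unitary.
by exists z; rewrite trmxCK invmx_unitary.
Qed.

Lemma char_poly_unitary_diag n (W : 'M[C]_n) (z : 'rV[C]_n) :
  W \is unitarymx ->
  char_poly (W *m diag_mx z *m W^t*) = \prod_i ('X - (z 0 i)%:P).
Proof.
move=> uW; rewrite /char_poly.
have -> : char_poly_mx (W *m diag_mx z *m W^t*) =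
    map_mx polyC W *m char_poly_mx (diag_mx z) *m map_mx polyC (W^t*).
  rewrite /char_poly_mx mulmxBr mulmxBl -!map_mxM; congr (_ - _).
  by rewrite scalar_mxC -mulmxA -map_mxM (unitarymxP uW) map_mx1 mulmx1.
rewrite !det_mulmx mulrAC -det_mulmx -map_mxM (unitarymxP uW) map_mx1 det1 mul1r.
rewrite -/(char_poly _) char_poly_trig ?diag_mx_is_trig //.
by apply: eq_bigr => i _; rewrite mxE eqxx mulr1n.
Qed.

End Adjoint.

Section Spectrum.
Variables (R : realType) (d : nat).
Notation C := R[i].
Implicit Types (x s g : 'rV[R]_d) (A B S G W U : 'M[C]_d).

Definition realdiag x : 'M[C]_d := diag_mx (map_mx (real_complex R) x).

Lemma realdiagB x y : realdiag (x - y) = realdiag x - realdiag y.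
Proof. by rewrite /realdiag map_mxB linearB. Qed.

Lemma conj_real (r : R) : Num.conj (r%:C) = r%:C.
Proof. by apply/CrealP; rewrite complex_real. Qed.

(** Commuting selfadjoint [S] and [G] make [S + i G] normal; a unitary
    diagonalisation of this one matrix diagonalises its real and imaginary
    parts [S] and [G] at once. *)
Lemma codiagonalize S G : S \is hermsymmx -> G \is hermsymmx ->
  S *m G = G *m S ->
  exists2 W : 'M[C]_d, W \is unitarymx &
    exists s g, S = W *m realdiag s *m W^t* /\ G = W *m realdiag g *m W^t*.
Proof.
move=> /hermsymmxP hS /hermsymmxP hG cSG.
pose j : C := 'i%C.
have jC : Num.conj j = - j by apply/eqP; rewrite eq_complex /= oppr0 !eqxx.
have jj : j * j = -1 by rewrite -expr2 sqr_i.
have j0 : j != 0 by apply/eqP => j0; move: jj; rewrite j0 mul0r; apply/eqP;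
  rewrite eq_sym oppr_eq0 oner_eq0.
pose A := S + j *: G.
have aA : A^t* = S - j *: G by rewrite adjD adjZ hS hG jC scaleNr.
have [|W uW [z Az]] := @normal_diag _ _ A.
  rewrite aA /A !mulmxBr !mulmxDr !mulmxBl !mulmxDl -!scalemxAl -!scalemxAr cSG.
  by rewrite opprD !addrA addrK addrNK.
have aA2 : A^t* = W *m diag_mx (map_mx Num.conj z) *m W^t*.
  by rewrite Az !adjM trmxCK mulmxA tr_diag_mx map_diag_mx.
have nz2 : (2 : C) != 0 by rewrite pnatr_eq0.
have SE : S = 2^-1 *: (A + A^t*).
  by rewrite aA /A addrACA subrr addr0 -mulr2n -[S *+ 2]scaler_nat scalerA mulVf ?scale1r.
have GE : G = (2 * j)^-1 *: (A - A^t*).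
  rewrite aA /A opprB addrC addrA addrNK -mulr2n -[(_ *: _) *+ 2]scaler_nat !scalerA.
  by rewrite mulVf ?scale1r // mulf_neq0.
exists W => //.
exists (map_mx (@complex.Re R) z), (map_mx (@complex.Im R) z); split.
  rewrite SE {1}Az aA2 -mulmxDl -mulmxDr -linearD scalemxAl scalemxAr.
  congr (_ *m _ *m _); rewrite -linearZ; congr diag_mx; apply/rowP => i.
  rewrite !mxE; apply: (mulfI nz2); rewrite mulrA divff // mul1r.
  by rewrite -addcJ.
rewrite GE {1}Az aA2 -mulmxBl -mulmxBr -linearB scalemxAl scalemxAr.
congr (_ *m _ *m _); rewrite -linearZ; congr diag_mx; apply/rowP => i.
have nzj : 2 * j != 0 by rewrite mulf_neq0.
rewrite !mxE; apply: (mulfI nzj); rewrite mulrA divff // mul1r.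
by rewrite mulrAC -subcJ.
Qed.

Lemma spectrum_unitary_diag W (z : 'rV[C]_d) : W \is unitarymx ->
  perm_eq (spectrum (W *m diag_mx z *m W^t*)) [seq z 0 i | i <- enum 'I_d].
Proof.
move=> uW; apply: prod_XsubC_eq; rewrite /spectrum; case: closed_field_poly_normal.
move=> r /= ; rewrite (monicP (char_poly_monic _)) scale1r => <-.
by rewrite char_poly_unitary_diag // big_map big_enum.
Qed.

(** Sorting forgets the order of the list, so the choice of an enumeration of the
    roots of the characteristic polynomial does not matter. *)
Lemma decreasing_row_perm (u v : seq R) : perm_eq u v ->
  decreasing_row d u = decreasing_row d v.
Proof.
move=> puv; apply/rowP => i; rewrite !mxE; congr nth.
apply/perm_sortP => //; [exact: ge_total|exact: ge_trans|exact: ge_anti].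
Qed.

Lemma lambda_unitary_diag W x : W \is unitarymx ->
  lambda (W *m realdiag x *m W^t*) = rearr x.
Proof.
move=> uW; apply: decreasing_row_perm.
apply: (perm_trans (perm_map _ (spectrum_unitary_diag _ uW))).
by rewrite -map_comp; under eq_map do rewrite /= mxE /=.
Qed.

(** Any reindexing that makes [x] non-increasing computes [rearr x]; ties make the
    reindexing non-unique, which is what allows one to sort two vectors at once. *)
Lemma rearr_sorting x (f : 'I_d -> 'I_d) : injective f ->
  (forall i j : 'I_d, (i <= j)%N -> x 0 (f j) <= x 0 (f i)) ->
  rearr x = \row_i x 0 (f i).
Proof.
move=> injf hf; set y := \row_i _.
have -> : rearr x = rearr y.
  apply: decreasing_row_perm; rewrite perm_sym.
  have -> : [seq y 0 i | i <- enum 'I_d] = [seq x 0 i | i <- [seq f i | i <- enum 'I_d]].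
    by rewrite -map_comp; apply: eq_map => i; rewrite /= mxE.
  apply: perm_map; apply: uniq_perm; rewrite ?(map_inj_uniq injf); try exact: enum_uniq.
  by move=> i; rewrite mem_enum; apply/mapP; exists (invF injf i); rewrite ?mem_enum ?f_invF.
apply/rowP => i; rewrite [LHS]mxE sorted_sort; last 2 first.
- exact: ge_trans.
- apply/(sortedP 0) => k; rewrite size_map -cardE card_ord => kn.
  have kn1 := ltnW kn.  rewrite !(nth_map i) -?enumT -?cardE ?card_ord //.
  by rewrite !mxE; apply: hf; rewrite -?enumT !nth_enum_ord // ltnW.
by rewrite (nth_map i) ?nth_ord_enum // -cardE card_ord.
Qed.

Lemma total_sorting (le : rel 'I_d) : total le -> transitive le ->
  exists2 f : 'I_d -> 'I_d, injective f & forall i j : 'I_d, (i <= j)%N -> le (f i) (f j).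
Proof.
move=> tot tr; have szs : size (sort le (enum 'I_d)) == d.
  by rewrite size_sort -cardE card_ord.
have srt := sort_sorted tot (enum 'I_d).
have usrt : uniq (sort le (enum 'I_d)) by rewrite sort_uniq enum_uniq.
exists (fun i => nth i (sort le (enum 'I_d)) i).
  move=> i j /eqP; rewrite (set_nth_default j) ?(eqP szs) // nth_uniq ?(eqP szs) //.
  by move=> /eqP/val_inj.
move=> i j ij; rewrite (set_nth_default j i) ?(eqP szs) //.
apply: (sorted_leq_nth tr) => //; rewrite ?inE ?(eqP szs) //.
by move=> k; have := tot k k; rewrite orbb.
Qed.

(** The absence of strict inversions is exactly what makes the lexicographic order
    on the pairs [(s i, g i)] sort both coordinates. *)
Lemma common_sorting s g : (forall i j, s 0 j < s 0 i -> g 0 j <= g 0 i) ->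
  exists f : 'I_d -> 'I_d, [/\ injective f, rearr s = \row_i s 0 (f i) &
    rearr g = \row_i g 0 (f i)].
Proof.
move=> sg.
pose le : rel 'I_d := fun i j => (s 0 j < s 0 i) || ((s 0 j == s 0 i) && (g 0 j <= g 0 i)).
have [||f injf hf] := @total_sorting le.
- by move=> i j; rewrite /le; case: ltgtP => //= _; exact: le_total.
- move=> j i k; rewrite /le => /orP[ij|/andP[/eqP-> gij]] /orP[jk|/andP[/eqP-> gjk]].
  + by rewrite (lt_trans jk ij).
  + by rewrite ij.
  + by rewrite jk.
  + by rewrite eqxx (le_trans gjk gij) orbT.
exists f; split => //; apply: rearr_sorting => // i j /hf /orP[].
- exact: ltW.
- by case/andP => /eqP->.
- exact: sg.
- by case/andP.
Qed.

Lemma realdiag_sorting W x (f : 'I_d -> 'I_d) : injective f ->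
  W *m realdiag x *m W^t* =
  colsub f W *m realdiag (\row_i x 0 (f i)) *m (colsub f W)^t*.
Proof.
move=> injf; apply/matrixP => i j; rewrite !mul_mx_diag !mxE.
rewrite (reindex_inj injf); apply: eq_bigr => k _.
by rewrite !mxE.
Qed.

Lemma colsub_unitary W (f : 'I_d -> 'I_d) : injective f ->
  W \is unitarymx -> colsub f W \is unitarymx.
Proof.
move=> injf /unitarymxP uW; apply/unitarymxP; rewrite -uW.
apply/matrixP => i j; rewrite !mxE [RHS](reindex_inj injf); apply: eq_bigr => k _.
by rewrite !mxE.
Qed.

Lemma hermitian_diag A : A \is hermsymmx ->
  exists2 W : 'M[C]_d, W \is unitarymx & A = W *m realdiag (lambda A) *m W^t*.
Proof.
move=> hA; have [W uW [x [_ [Ax _]]]] := codiagonalize hA hA erefl.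
have [f [injf xf _]] := @common_sorting x x (fun i j => @ltW _ _ _ _).
exists (colsub f W); first exact: colsub_unitary.
by rewrite {2}Ax lambda_unitary_diag // xf -realdiag_sorting.
Qed.

Lemma sorted_codiag W s g : W \is unitarymx ->
  (forall i j, s 0 j < s 0 i -> g 0 j <= g 0 i) ->
  exists2 V : 'M[C]_d, V \is unitarymx &
   W *m realdiag s *m W^t* = V *m realdiag (rearr s) *m V^t* /\
   W *m realdiag g *m W^t* = V *m realdiag (rearr g) *m V^t*.
Proof.
move=> uW /common_sorting[f [injf -> ->]].
exists (colsub f W); first exact: colsub_unitary.
by split; apply: realdiag_sorting.
Qed.

Lemma lambda_conj U A : U \is unitarymx -> A \is hermsymmx ->
  lambda (U *m A *m U^t*) = lambda A.
Proof.
move=> uU /hermitian_diag[W uW AE].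
rewrite [in LHS]AE [in RHS]AE (unitary_conj_comp U W).
by rewrite (lambda_unitary_diag _ (mul_unitarymx uU uW)) lambda_unitary_diag.
Qed.

Lemma orbit_conj (mu : 'rV[R]_d) U G : U \is unitarymx -> orbit_of mu G ->
  orbit_of mu (U *m G *m U^t*).
Proof.
by move=> uU [hG lG]; split; [exact: hermsymmx_conj|rewrite lambda_conj].
Qed.

End Spectrum.

(** * The entry norm dominates every norm *)

Section EntryNorm.
Variable R : realType.
Notation C := R[i].

Lemma normc_ge0 (z : C) : 0 <= normc z.
Proof. by case: z => a b; exact: sqrtr_ge0. Qed.

Lemma normc_real (r : R) : normc r%:C = `|r|.
Proof. by rewrite /= expr0n addr0 sqrtr_sqr. Qed.

Lemma mul_conj_normc (z : C) : z * Num.conj z = (normc z ^+ 2)%:C.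
Proof. by rewrite -normCK rmorphXn. Qed.

Lemma normc_sum (I : Type) (r : seq I) (P : pred I) (F : I -> C) :
  normc (\sum_(i <- r | P i) F i) <= \sum_(i <- r | P i) normc (F i).
Proof.
elim/big_ind2: _ => [|x u y v hx hy|//]; first by rewrite normc0.
by rewrite (le_trans (le_normcD _ _)) ?lerD.
Qed.

(** A submultiplicative norm that bounds, up to a constant, all the norms in play,
    so that every perturbation estimate can be made entrywise. *)
Definition entry_norm m n (A : 'M[C]_(m, n)) : R := \sum_i \sum_j normc (A i j).

Lemma entry_norm_ge0 m n (A : 'M[C]_(m, n)) : 0 <= entry_norm A.
Proof. by do 2!apply: sumr_ge0 => ? _; exact: normc_ge0. Qed.

Lemma entry_norm0 m n : entry_norm (0 : 'M[C]_(m, n)) = 0.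
Proof. by rewrite /entry_norm big1 // => i _; rewrite big1 // => j _; rewrite mxE normc0. Qed.

Lemma entry_norm_eq0 m n (A : 'M[C]_(m, n)) : entry_norm A = 0 -> A = 0.
Proof.
have s0 i : 0 <= \sum_j normc (A i j) by apply: sumr_ge0 => j _; exact: normc_ge0.
move=> /eqP; rewrite psumr_eq0 // => /allP A0; apply/matrixP => i j.
have := A0 i (mem_index_enum _); rewrite psumr_eq0; last by move=> k _; exact: normc_ge0.
by move=> /allP/(_ j (mem_index_enum _))/eqP/eq0_normc ->; rewrite mxE.
Qed.

Lemma entry_normD m n (A B : 'M[C]_(m, n)) :
  entry_norm (A + B) <= entry_norm A + entry_norm B.
Proof.
rewrite /entry_norm -big_split /=; apply: ler_sum => i _.
rewrite -big_split /=; apply: ler_sum => j _; rewrite mxE; exact: le_normcD.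
Qed.

Lemma entry_normZ m n c (A : 'M[C]_(m, n)) :
  entry_norm (c *: A) = normc c * entry_norm A.
Proof.
rewrite /entry_norm mulr_sumr; apply: eq_bigr => i _.
by rewrite mulr_sumr; apply: eq_bigr => j _; rewrite mxE normcM.
Qed.

Lemma entry_normN m n (A : 'M[C]_(m, n)) : entry_norm (- A) = entry_norm A.
Proof.
by do 2!apply: eq_bigr => ? _; rewrite mxE normcN.
Qed.

Lemma entry_norm_adj m n (A : 'M[C]_(m, n)) : entry_norm (A^t*) = entry_norm A.
Proof.
rewrite /entry_norm exchange_big; do 2!apply: eq_bigr => ? _.
by rewrite !mxE; apply: complexI; exact: norm_conjC.
Qed.

Lemma entry_normM m n p (A : 'M[C]_(m, n)) (B : 'M[C]_(n, p)) :
  entry_norm (A *m B) <= entry_norm A * entry_norm B.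
Proof.
rewrite {2}/entry_norm mulr_suml {1}/entry_norm; apply: ler_sum => i _.
apply: (@le_trans _ _ (\sum_j \sum_k normc (A i k) * normc (B k j))).
  apply: ler_sum => j _; rewrite mxE (le_trans (normc_sum _ _ _)) //.
  by apply: ler_sum => k _; rewrite normcM.
rewrite exchange_big /= mulr_suml; apply: ler_sum => k _.
rewrite -mulr_sumr ler_wpM2l ?normc_ge0 //.
rewrite /entry_norm (bigD1 k) //= lerDl.
by do 2!apply: sumr_ge0 => ? _; exact: normc_ge0.
Qed.

Lemma entry_norm_sandwich m n p q (A : 'M[C]_(m, n)) (B : 'M[C]_(n, p))
    (D : 'M[C]_(p, q)) :
  entry_norm (A *m B *m D) <= entry_norm A * entry_norm B * entry_norm D.
Proof.
apply: (le_trans (entry_normM _ _)).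
by rewrite ler_wpM2r ?entry_norm_ge0 ?entry_normM.
Qed.

Lemma sum_sq_eq1_le1 (I : finType) (F : I -> R) i :
  (forall j, 0 <= F j) -> \sum_j F j ^+ 2 = 1 -> F i <= 1.
Proof.
move=> F0 F1; rewrite -(@ler_pXn2r _ 2) ?nnegrE // expr1n -F1 (bigD1 i) //=.
by rewrite lerDl sumr_ge0 // => j _; rewrite sqr_ge0.
Qed.

Lemma unitary_entry_le1 d (U : 'M[C]_d) i j : U \is unitarymx ->
  normc (U i j) <= 1.
Proof.
move=> /unitarymxP/matrixP/(_ i i); rewrite !mxE eqxx => U1.
apply: (@sum_sq_eq1_le1 _ (fun j => normc (U i j))).
  by move=> k; exact: normc_ge0.
apply: complexI; rewrite rmorph_sum rmorph1 -[RHS]U1; apply: eq_bigr => k _.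
by rewrite !mxE; exact/esym/mul_conj_normc.
Qed.

Lemma entry_norm_unitary d (U : 'M[C]_d) : U \is unitarymx ->
  entry_norm U <= (d * d)%:R.
Proof.
move=> uU; apply: (@le_trans _ _ (\sum_(i < d) \sum_(j < d) 1)).
  by do 2!apply: ler_sum => ? _; exact: unitary_entry_le1.
rewrite (eq_bigr (fun=> d%:R)); last first.
  by move=> ? _; rewrite sumr_const card_ord.
by rewrite sumr_const card_ord natrM mulr_natr.
Qed.

Lemma l2norm_le_entry_norm d (x : 'cV[C]_d) : l2norm x <= entry_norm x.
Proof.
have -> : entry_norm x = \sum_i normc (x i 0).
  by apply: eq_bigr => i _; rewrite big_ord1.
have s0 : 0 <= \sum_i normc (x i 0) by apply: sumr_ge0 => i _; exact: normc_ge0.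
rewrite -[leRHS]ger0_norm // -sqrtr_sqr ler_wsqrtr // [leRHS]expr2 mulr_suml.
apply: ler_sum => i _; rewrite expr2 ler_wpM2l ?normc_ge0 // (bigD1 i) //= lerDl.
by apply: sumr_ge0 => j _; exact: normc_ge0.
Qed.

(** Used to check that a competitor is close enough to the local minimizer. *)
Lemma spectral_norm_le d (A : 'M[C]_d) : spectral_norm A <= entry_norm A.
Proof.
rewrite /spectral_norm; set E := (X in sup X).
have [E0|/eqP/set0P E0] := pselect (E = set0).
  (* In dimension 0 there is no unit vector and the supremum is that of the
     empty set, namely 0. *)
  by rewrite E0 sup0 entry_norm_ge0.
apply: ge_sup => // _ [x /= x1 <-]; apply: (le_trans (l2norm_le_entry_norm _)).
have xle k : normc (x k 0) <= 1.
  apply: (@sum_sq_eq1_le1 _ (fun j => normc (x j 0))).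
    by move=> j; exact: normc_ge0.
  have /(congr1 (fun r => r ^+ 2)) := x1; rewrite sqr_sqrtr ?expr1n //.
  by apply: sumr_ge0 => j _; exact: sqr_ge0.
rewrite /entry_norm; apply: ler_sum => i _; rewrite big_ord1 mxE (le_trans (normc_sum _ _ _)) //.
by apply: ler_sum => k _; rewrite normcM ler_piMr ?normc_ge0.
Qed.

Lemma norm_le_entry_norm d (N : 'M[C]_d -> R) : is_norm N ->
  exists2 K, 0 <= K & forall A, N A <= K * entry_norm A.
Proof.
case=> N0 _ NZ ND; have Nz : N 0 = 0 by rewrite -(scale0r 0) NZ normc0 mul0r.
have Nsum (I : finType) (F : I -> 'M[C]_d) : N (\sum_i F i) <= \sum_i N (F i).
  elim/big_ind2: _ => [|x u y v hx hy|//]; first by rewrite Nz.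
  by rewrite (le_trans (ND _ _)) ?lerD.
exists (\sum_i \sum_j N (delta_mx i j)).
  by do 2!apply: sumr_ge0 => ? _; exact: N0.
move=> A; rewrite {1}(matrix_sum_delta A) mulr_sumr.
apply: (le_trans (Nsum _ _)); apply: ler_sum => i _.
rewrite mulr_sumr; apply: (le_trans (Nsum _ _)); apply: ler_sum => j _.
rewrite NZ mulrC ler_wpM2r ?normc_ge0 // (bigD1 i) //= (bigD1 j) //= -addrA lerDl.
apply: addr_ge0; first by apply: sumr_ge0.
by do 2!apply: sumr_ge0 => ? _.
Qed.

End EntryNorm.

(** * Cayley transforms *)

Section CayleyTransform.
Variables (C : numClosedFieldType) (d : nat).
Implicit Types (G Y : 'M[C]_d).

Lemma mul_adj_eq0 n (v : 'rV[C]_n) : v *m v^t* = 0 -> v = 0.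
Proof.
move=> /matrixP/(_ 0 0); rewrite !mxE => /eqP; rewrite psumr_eq0; last first.
  by move=> i _; rewrite !mxE; exact: mul_conjC_ge0.
move=> /allP v0; apply/rowP => i; rewrite mxE; apply/eqP.
by have := v0 i (mem_index_enum _); rewrite !mxE mul_conjC_eq0.
Qed.

(** The spectrum of a skew-adjoint matrix is imaginary: [v = v Y] forces the square
    norm of [v] to be equal to its own opposite. *)
Lemma skew_unit Y : Y^t* = - Y -> 1%:M - Y \in unitmx.
Proof.
move=> sY; rewrite -row_free_unit; apply: inj_row_free => v.
rewrite mulmxBr mulmx1 => /subr0_eq vY; apply: mul_adj_eq0.
have h1 : v *m v^t* = v *m Y *m v^t* by rewrite -vY.
have h2 : v *m v^t* = - (v *m Y *m v^t*).
  by rewrite {2}vY adjM sY mulNmx mulmxN mulmxA.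
have : (2 : C) *: (v *m v^t*) = 0 by rewrite scaler_nat mulr2n {1}h1 h2 subrr.
by move/eqP; rewrite scaler_eq0 pnatr_eq0 => /eqP.
Qed.

(** The displacement of [G] under the Cayley transform is exactly a commutator
    with [Y], sandwiched between [K] and its adjoint.  This follows from writing
    [G] itself as the sandwich of [(1 - Y) G (1 + Y)]. *)
Lemma cayley_transform Y G : Y^t* = - Y ->
  let K := invmx (1%:M - Y) in
  let U := K *m (1%:M + Y) in
  U \is unitarymx /\
  U *m G *m U^t* - G = 2 *: (K *m (Y *m G - G *m Y) *m K^t*).
Proof.
move=> sY K U; have KY : K *m (1%:M - Y) = 1%:M by rewrite mulVmx ?skew_unit.
have YK : (1%:M + Y) *m K^t* = 1%:M.
  by have := congr1 (fun Z => Z^t*) KY; rewrite /= adjM adjB adj1 sY opprK.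
have aYp : (1%:M + Y)^t* = 1%:M - Y by rewrite adjD adj1 sY.
have com : (1%:M + Y) *m (1%:M - Y) = (1%:M - Y) *m (1%:M + Y).
  rewrite !(mulmxDl, mulmxDr, mulmxN, mulNmx, mul1mx, mulmx1).
  by rewrite !addrA addrNK addrK.
split.
  apply/unitarymxP.
  by rewrite adjM aYp -mulmxA (mulmxA (_ + _)) com -mulmxA YK mulmx1.
have GE : G = K *m ((1%:M - Y) *m G *m (1%:M + Y)) *m K^t*.
  by rewrite -!mulmxA YK mulmx1 !mulmxA KY mul1mx.
have -> : U *m G *m U^t* = K *m ((1%:M + Y) *m G *m (1%:M - Y)) *m K^t*.
  by rewrite /U adjM aYp !mulmxA.
rewrite {2}GE -mulmxBl -mulmxBr scalemxAl scalemxAr; congr (_ *m _ *m _).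
rewrite !(mulmxDl, mulmxDr, mulmxN, mulNmx, mul1mx, mulmx1).
move: (Y *m G *m Y) (Y *m G) (G *m Y) => c a b.
by apply/matrixP => i j; rewrite !mxE; ring.
Qed.

End CayleyTransform.

Section CayleyPath.
Variables (R : realType) (d : nat).
Notation C := R[i].
Implicit Types (G X Y : 'M[C]_d).

(** A curve of unitary matrices with prescribed velocity [X] at the identity, with a
    quadratic control of the remainder.  The Cayley transform plays the role of
    the exponential, and its factor [K] is bounded because [2 K = U + 1]. *)
Lemma cayley_path X G : X^t* = - X ->
  exists2 M : R, 0 <= M & forall t : R, 0 <= t <= 1 ->
  exists2 U : 'M[C]_d, U \is unitarymx &
    entry_norm (U *m G *m U^t* - G - t%:C *: (X *m G - G *m X)) <= M * t ^+ 2.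
Proof.
move=> sX; have [B BE] : exists B, B = X *m G - G *m X by eexists.
rewrite -BE; pose q : R := (d * d)%:R.
have q0 : 0 <= q by exact: ler0n.
exists (2^-1 * q * entry_norm X * entry_norm B * (q + 1)).
  by rewrite !mulr_ge0 ?entry_norm_ge0 ?addr_ge0 ?invr_ge0.
move=> t /andP[t0 t1].
pose Y : 'M[C]_d := (t / 2)%:C *: X.
have sY : Y^t* = - Y by rewrite adjZ conj_real sX scalerN.
have [] := cayley_transform G sY.
have : invmx (1%:M - Y) *m (1%:M - Y) = 1%:M by rewrite mulVmx ?skew_unit.
move: (invmx _) => K KY uU UE.
have {}UE : K *m (1%:M + Y) *m G *m (K *m (1%:M + Y))^t* - G =
    t%:C *: (K *m B *m K^t*).
  rewrite UE BE -scalemxAl -scalemxAr -scalerBr.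
  rewrite -scalemxAr -scalemxAl scalerA; congr (_ *: _).
  by rewrite -(rmorph_nat (real_complex R)) -rmorphM; congr _%:C; field.
exists (K *m (1%:M + Y)) => //; rewrite UE -scalerBr entry_normZ normc_real ger0_norm //.
have K1 : K - 1%:M = K *m Y.
  by rewrite -[X in _ - X]KY mulmxBr mulmx1 opprB addrC addrNK.
have KE : (2 : C) *: K = K *m (1%:M + Y) + 1%:M.
  by rewrite mulmxDr mulmx1 -K1 addrA subrK scaler_nat mulr2n.
have nK : entry_norm K <= q.
  have h : 2 * entry_norm K <= q + q.
    have -> : 2 * entry_norm K = entry_norm ((2 : C) *: K).
      by rewrite entry_normZ -[2 in RHS](rmorph_nat (real_complex R)) normc_real ger0_norm.
    rewrite KE; apply: (le_trans (entry_normD _ 1%:M)).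
    have u1 : (1%:M : 'M[C]_d) \is unitarymx by apply/unitarymxP; rewrite adj1 mulmx1.
    exact: lerD (entry_norm_unitary uU) (entry_norm_unitary u1).
  lra.
have -> : K *m B *m K^t* - B = K *m Y *m B *m K^t* + B *m (K *m Y)^t*.
  rewrite -K1 adjB adj1 !mulmxBl mul1mx mulmxBr mulmx1.
  by rewrite addrA addrNK.
have nY : entry_norm Y = t / 2 * entry_norm X.
  by rewrite entry_normZ normc_real ger0_norm // divr_ge0.
have nKY : entry_norm (K *m Y) <= q * (t / 2 * entry_norm X).
  by rewrite (le_trans (entry_normM _ _)) // nY ler_wpM2r // mulr_ge0 ?entry_norm_ge0 ?divr_ge0.
have b0 := entry_norm_ge0 B; have x0 := entry_norm_ge0 X; have k0 := entry_norm_ge0 K.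
have ky0 := entry_norm_ge0 (K *m Y).
have h1 : entry_norm (K *m Y *m B *m K^t*) <= q * (t / 2 * entry_norm X) * entry_norm B * q.
  rewrite (le_trans (entry_norm_sandwich _ _ _)) // entry_norm_adj.
  by rewrite ler_pM ?mulr_ge0 ?ler_wpM2r.
have h2 : entry_norm (B *m (K *m Y)^t*) <= entry_norm B * (q * (t / 2 * entry_norm X)).
  by rewrite (le_trans (entry_normM _ _)) // entry_norm_adj ler_wpM2l.
have -> : 2^-1 * q * entry_norm X * entry_norm B * (q + 1) * t ^+ 2 = 
  t * (q * (t / 2 * entry_norm X) * entry_norm B * q + entry_norm B * (q * (t / 2 * entry_norm X))).
  by field.
by rewrite ler_wpM2l // (le_trans (entry_normD _ _)) ?lerD.
Qed.
End CayleyPath.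

(** * First-order condition and commutation *)

Section Descent.
Variables (R : realType) (d : nat) (N : 'M[R[i]]_d -> R).
Notation C := R[i].
Hypotheses (hN : is_norm N) (hui : unitarily_invariant N).
Implicit Types (A B S G W U X Y : 'M[C]_d).

Lemma norm_conj U A : U \is unitarymx -> N (U *m A *m U^t*) = N A.
Proof. by move=> uU; exact: hui (adj_unitary uU). Qed.

Lemma normZ_real (r : R) A : 0 <= r -> N (r%:C *: A) = r * N A.
Proof. by move=> r0; rewrite (normZ hN) normc_real ger0_norm. Qed.

(** The normalisation to the unit sphere in the hypothesis is removed by scaling; a
    common norm 0 is excluded since it would force both matrices to vanish. *)
Lemma strict_convexity A B (t : R) : strictly_convex N ->
  N A = N B -> A <> B -> 0 < t < 1 ->
  N (t%:C *: A + (1 - t)%:C *: B) < N A.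
Proof.
move=> hsc AB neAB t01.
have n0 : 0 < N A.
  rewrite lt0r (norm_ge0 hN) andbT; apply/eqP => NA0.
  by apply: neAB; rewrite (norm_eq0 hN NA0) (norm_eq0 hN (esym (etrans (esym NA0) AB))).
have nz : N A != 0 by rewrite gt_eqF.
have i0 : 0 <= (N A)^-1 by rewrite invr_ge0 ltW.
have zC : ((N A)^-1)%:C != 0 :> C by rewrite fmorph_eq0 invr_eq0.
have := hsc (((N A)^-1)%:C *: A) (((N A)^-1)%:C *: B) t.
rewrite !normZ_real // -AB mulVf // => /(_ erefl erefl _ t01).
rewrite !scalerA ![_%:C * ((N A)^-1)%:C]mulrC -!scalerA -scalerDr normZ_real //.
rewrite mulrC ltr_pdivrMr // mul1r; apply.
by move=> /(scalerI zC).
Qed.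

(** Suppose that subtracting the commutator [B] lowered the norm by a definite amount
    [dl].  By convexity subtracting [t B] would lower it by at least [t dl], and
    the curve of [cayley_path] realises this inside the orbit up to an error of
    order [t^2]: for small [t] the local minimum would be beaten. *)
Lemma first_order_condition mu S G X :
  local_minimizer (orbit_of mu) (fun G => N (S - G)) G -> X^t* = - X ->
  N (S - G) <= N (S - G - (X *m G - G *m X)).
Proof.
move=> [oG [e e0 minG]] sX; set B := X *m G - G *m X; set A := S - G.
have [M M0 path] := cayley_path G sX; rewrite -/B in path.
have [K K0 NK] := norm_le_entry_norm hN.
have b0 := entry_norm_ge0 B.
rewrite leNgt; apply/negP => lt; pose dl := N A - N (A - B).
have dl0 : 0 < dl by rewrite subr_gt0.
have KM0 : 0 <= K * M by rewrite mulr_ge0.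
(* The assumption on [t] keeps the competitor in the ball of radius [e]; the
   comparison then bounds the hypothetical gain by the remainder. *)
have step (t : R) : 0 < t -> t <= 1 -> t * entry_norm B + M * t ^+ 2 < e -> dl <= K * M * t.
  move=> t0 t1 te; have /path[U uU UG] : 0 <= t <= 1 by rewrite ltW.
  set E := U *m G *m U^t* - G - t%:C *: B in UG.
  have /minG : orbit_of mu (U *m G *m U^t*) by exact: orbit_conj.
  have -> : U *m G *m U^t* - G = E + t%:C *: B by rewrite subrK.
  have lte : spectral_norm (E + t%:C *: B) < e.
    apply: le_lt_trans te; rewrite (le_trans (spectral_norm_le _)) //.
    rewrite (le_trans (entry_normD _ _)) // addrC lerD //.
    by rewrite entry_normZ normc_real ger0_norm // ltW.
  move=> /(_ lte).
  have -> : S - U *m G *m U^t* =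
      (1 - t)%:C *: A + t%:C *: (A - B) - E.
    rewrite /E rmorphB rmorph1 scalerBl scale1r [_ *: (A - B)]scalerBr /A.
    move: (U *m G *m U^t*) (t%:C *: B) (t%:C *: (S - G)) => a b c.
    by apply/matrixP => i j; rewrite !mxE; ring.
  have NN : N (- E) = N E by rewrite -scaleN1r (normZ hN) normcN normc1 mul1r.
  move=> h.
  have := le_trans h (norm_triangle hN _ _); rewrite NN.
  have h2 := norm_triangle hN ((1 - t)%:C *: A) (t%:C *: (A - B)).
  rewrite !normZ_real ?subr_ge0 ?(ltW t0) // in h2.
  have h3 : N E <= K * (M * t ^+ 2) by rewrite (le_trans (NK _)) // ler_wpM2l.
  move=> h1; rewrite -(ler_pM2l t0).
  have : N A <= (1 - t) * N A + t * N (A - B) + K * (M * t ^+ 2).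
    by apply: (le_trans h1); rewrite lerD.
  rewrite /dl => h4.
  have : t * (N A - N (A - B)) <= K * (M * t ^+ 2) by lra.
  by have -> : t * (K * M * t) = K * (M * t ^+ 2) by ring.
pose t1 := e / (2 * (entry_norm B + M + 1)); pose t2 := dl / (2 * (K * M + 1)).
have d1 : 0 < entry_norm B + M + 1 by rewrite ltr_wpDl ?addr_ge0.
have d2 : 0 < K * M + 1 by rewrite ltr_wpDl.
have t10 : 0 < t1 by rewrite divr_gt0 ?mulr_gt0.
have t20 : 0 < t2 by rewrite divr_gt0 ?mulr_gt0.
pose t := Num.min 1 (Num.min t1 t2).
have t0 : 0 < t by rewrite !lt_min ltr01 t10.
have tt : t <= 1 by rewrite ge_min lexx.
have tt1 : t <= t1 by rewrite !ge_min lexx orbT.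
have tt2 : t <= t2 by rewrite !ge_min lexx !orbT.
have e1 : t * (entry_norm B + M + 1) <= e / 2.
  rewrite (le_trans (ler_wpM2r (ltW d1) tt1)) // /t1 le_eqVlt; apply/orP; left.
  by apply/eqP; field; rewrite gt_eqF.
have e2 : t * (K * M + 1) <= dl / 2.
  rewrite (le_trans (ler_wpM2r (ltW d2) tt2)) // /t2 le_eqVlt; apply/orP; left.
  by apply/eqP; field; rewrite gt_eqF.
have /(step _ t0 tt) : t * entry_norm B + M * t ^+ 2 < e.
  have : M * t ^+ 2 <= M * t by rewrite ler_wpM2l // expr2 ler_piMl // ltW.
  lra.
lra.
Qed.

(** In an eigenbasis of [G], commutation of [A = S - G] with [G] means that [A k l]
    vanishes whenever the eigenvalues at [k] and [l] differ.  Otherwise the sign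
    change [V] of the eigenspace containing [k] moves [A], and the average of [A]
    with its conjugate by [V] contradicts the first-order condition. *)
Lemma hermitian_commute mu S G : strictly_convex N -> S \is hermsymmx ->
  local_minimizer (orbit_of mu) (fun G => N (S - G)) G ->
  S *m G = G *m S.
Proof.
move=> hsc hS minG; have hG : G \is hermsymmx by case: minG => -[].
have [W uW [g [_ [GE _]]]] := codiagonalize hG hG erefl.
pose A := W^t* *m (S - G) *m W.
have /hermsymmxP hA : A \is hermsymmx.
  by rewrite /A -{2}[W]trmxCK; apply/hermsymmx_conj/hermsymmxB.
have AE : S - G = W *m A *m W^t*.
  by rewrite /A !mulmxA (unitarymxP uW) mul1mx mulmxtVK.
clearbody A.
have [D Dg] : exists D, D = realdiag g by eexists.
rewrite -Dg in GE.
suff com : A *m D = D *m A.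
  have com2 : (S - G) *m G = G *m (S - G).
    rewrite AE GE (unitary_conj_mul A D uW).
    by rewrite (unitary_conj_mul D A uW) com.
  by move: com2; rewrite mulmxBl mulmxBr => /addIr.
pose gC i : C := (g 0 i)%:C.
have DE i j : (A *m D) i j = A i j * gC j /\ (D *m A) i j = gC i * A i j.
  by rewrite Dg /realdiag mul_mx_diag mul_diag_mx !mxE.
apply/matrixP => k l; have [-> ->] := DE k l.
apply/eqP/negPn/negP => ne.
have Akl : A k l != 0 by apply: contra_neq ne => ->; rewrite mul0r mulr0.
have gkl : g 0 l != g 0 k.
  by apply: contra_neq ne => gkl; rewrite /gC gkl mulrC.
pose fl i := g 0 i == g 0 k.
have flg i j : fl i != fl j -> gC j - gC i != 0.
  apply: contra_neq => /subr0_eq /complexI; rewrite /fl => ->.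
  by [].
(* [X] solves [X D - D X = A] on the entries that [V] changes; the divisor
   is the difference of two distinct eigenvalues there. *)
pose X := \matrix_(i, j) if fl i == fl j then 0 else A i j / (gC j - gC i).
pose sg i : C := if fl i then -1 else 1.
pose V : 'M[C]_d := diag_mx (\row_i sg i).
have sgsg i : sg i * sg i = 1 by rewrite /sg; case: ifP => _; rewrite ?mulrNN mulr1.
have sgC i : Num.conj (sg i) = sg i.
  by rewrite /sg; case: ifP => _; rewrite ?rmorphN rmorph1.
have VC : V^t* = V.
  rewrite tr_diag_mx map_diag_mx; congr diag_mx; apply/rowP => i.
  by rewrite !mxE; exact: sgC.
have uV : V \is unitarymx.
  apply/unitarymxP; rewrite VC mul_diag_mx; apply/matrixP => i j.
  by rewrite !mxE mulrnAr sgsg.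
have VAV i j : (V *m A *m V^t*) i j = sg i * A i j * sg j.
  by rewrite VC mul_mx_diag mul_diag_mx !mxE.
have XE : A - (X *m D - D *m X) =
    (2^-1)%:C *: A + (1 - 2^-1)%:C *: (V *m A *m V^t*).
  have -> : 1 - 2^-1 = 2^-1 :> R by lra.
  rewrite rmorphV ?unitfE ?pnatr_eq0 // rmorph_nat.
  move: (V *m A *m V^t*) VAV => B BE.
  apply/matrixP => i j; rewrite Dg /realdiag mul_mx_diag mul_diag_mx.
  rewrite !mxE -/(gC i) -/(gC j) BE /sg.
  case fi : (fl i); case fj : (fl j) => /=; try (by field).
    by field; apply: flg; rewrite fi fj.
  by field; apply: flg; rewrite fi fj.
have sX : X^t* = - X.
  apply/matrixP => i j; rewrite !mxE eq_sym; case: eqVneq => fij.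
    by rewrite oppr0 rmorph0.
  have := congr1 (fun M : 'M[C]_d => M i j) hA; rewrite !mxE => hAij.
  have := conj_real (g 0 i); have := conj_real (g 0 j); rewrite -/(gC i) -/(gC j) => gj gi.
  have E : Num.conj (A j i / (gC i - gC j)) =
      Num.conj (A j i) / (Num.conj (gC i) - Num.conj (gC j)).
    by rewrite rmorphM fmorphV rmorphB.
  apply: (etrans E); rewrite (hAij : Num.conj (A j i) = A i j) gi gj.
  by rewrite -mulrN -invrN opprB.
have sX' : (W *m X *m W^t*)^t* = - (W *m X *m W^t*).
  by rewrite !adjM trmxCK sX mulmxA mulmxN mulNmx.
have := first_order_condition minG sX'.
have -> : S - G - (W *m X *m W^t* *m G - G *m (W *m X *m W^t*)) =
    W *m (A - (X *m D - D *m X)) *m W^t*.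
  rewrite AE GE (unitary_conj_mul X D uW).
  by rewrite (unitary_conj_mul D X uW) -!mulmxBl -!mulmxBr.
rewrite AE !norm_conj // XE leNgt => /negP; apply.
apply: strict_convexity => //; first by rewrite norm_conj.
  move=> /matrixP/(_ k l); rewrite VAV /sg /fl eqxx (negbTE gkl) mulr1 mulN1r.
  move=> /eqP; rewrite -subr_eq0 opprK -mulr2n mulrn_eq0 (negbTE Akl) //.
lra.
Qed.

End Descent.

(** * Planar reflections *)

(** [P] is a projection and [Z], [X] are anticommuting involutions of its image, as
    the Pauli matrices are in a coordinate plane. *)
Section PauliRelations.
Variables (F : fieldType) (n : nat) (P Z X : 'M[F]_n).
Hypotheses (ZZ : Z *m Z = P) (XX : X *m X = P) (XZ : X *m Z = - (Z *m X)).
Hypotheses (PZ : P *m Z = Z) (PX : P *m X = X).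
Hypotheses (ZP : Z *m P = Z) (XP : X *m P = X).
Implicit Types (a b r : F) (B D E : 'M[F]_n).

(** When [a^2 + b^2 = 1] this is the reflection [a Z + b X] of the plane, extended by
    the identity. *)
Definition pauli_reflection a b := 1%:M - P + a *: Z + b *: X.

Lemma pauli_reflection_mul a b B :
  pauli_reflection a b *m B = B - P *m B + a *: (Z *m B) + b *: (X *m B).
Proof. by rewrite !(mulmxDl, mulNmx) mul1mx -!scalemxAl. Qed.

Lemma mul_pauli_reflection a b B :
  B *m pauli_reflection a b = B - B *m P + a *: (B *m Z) + b *: (B *m X).
Proof. by rewrite !(mulmxDr, mulmxN) mulmx1 -!scalemxAr. Qed.

Let PP : P *m P = P. Proof. by rewrite -{2}ZZ mulmxA PZ. Qed.
Let WP : Z *m X *m P = Z *m X. Proof. by rewrite -mulmxA XP. Qed.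
Let WZ : Z *m X *m Z = - X.
Proof. by rewrite -mulmxA XZ mulmxN mulmxA ZZ PX. Qed.
Let WX : Z *m X *m X = Z. Proof. by rewrite -mulmxA XX ZP. Qed.

Lemma pauli_reflection_invol a b : a ^+ 2 + b ^+ 2 = 1 ->
  pauli_reflection a b *m pauli_reflection a b = 1%:M.
Proof.
move=> ab; rewrite pauli_reflection_mul !mul_pauli_reflection.
rewrite PP PZ PX ZP XP ZZ XX XZ.
have ab' : b ^+ 2 = 1 - a ^+ 2 by rewrite -ab addrAC subrr add0r.
rewrite /pauli_reflection; apply/matrixP => i j; rewrite !mxE.
move: (P i j) (Z i j) (X i j) (\sum_k _) => p z x w; ring: ab'.
Qed.

(** The hypothesis on [D] says that [D - r Z] commutes with the reflection, so that
    only the component [r Z] is moved; the reflection turns [Z] by twice its own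
    angle. *)
Lemma pauli_reflection_conj a b r D : a ^+ 2 + b ^+ 2 = 1 ->
  D *m P = P *m D -> D *m Z = Z *m D ->
  D *m X - X *m D = (2 * r) *: (Z *m X) ->
  pauli_reflection a b *m D *m pauli_reflection a b =
  D + r *: ((- (2 * b ^+ 2)) *: Z + (2 * a * b) *: X).
Proof.
move=> ab cP cZ cX; pose E := D - r *: Z.
have DE : D = E + r *: Z by rewrite subrK.
have cEP : E *m P = P *m E.
  by rewrite /E mulmxBl mulmxBr -scalemxAl -scalemxAr ZP PZ cP.
have cEZ : E *m Z = Z *m E.
  by rewrite /E mulmxBl mulmxBr -scalemxAl -scalemxAr cZ.
have cEX : E *m X = X *m E.
  rewrite /E mulmxBl mulmxBr -scalemxAl -scalemxAr XZ.
  rewrite (canRL (subrK _) cX); move: (Z *m X) (X *m D) => w v.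
  by apply/matrixP => i j; rewrite !mxE; ring.
have cEH : pauli_reflection a b *m E = E *m pauli_reflection a b.
  by rewrite pauli_reflection_mul mul_pauli_reflection cEP cEZ cEX.
have HZH : pauli_reflection a b *m Z *m pauli_reflection a b =
    (1 - 2 * b ^+ 2) *: Z + (2 * a * b) *: X.
  rewrite pauli_reflection_mul PZ subrr add0r ZZ XZ scalerN mulmxBl.
  rewrite -!scalemxAl !mul_pauli_reflection PP PZ PX WP WZ WX !subrr !add0r.
  have ab' : a ^+ 2 = 1 - b ^+ 2 by rewrite -ab addrK.
  by apply/matrixP => i j; rewrite !mxE; ring: ab'.
rewrite {1}DE (mulmxDr _ E) (mulmxDl (_ *m E)) cEH -(mulmxA E) pauli_reflection_invol // mulmx1.
rewrite -scalemxAr -scalemxAl HZH DE; clearbody E.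
by apply/matrixP => i j; rewrite !mxE; ring.
Qed.

End PauliRelations.

Section Reflection.
Variables (R : realType) (d : nat) (i j : 'I_d).
Hypothesis ij : i != j.
Notation C := R[i].
Implicit Types (A B S G W U X Y : 'M[C]_d) (e a s g : 'rV[R]_d).

Definition pauliP : 'M[C]_d := delta_mx i i + delta_mx j j.
Definition pauliZ : 'M[C]_d := delta_mx i i - delta_mx j j.
Definition pauliX : 'M[C]_d := delta_mx i j + delta_mx j i.
Definition reflection (al be : R) : 'M[C]_d :=
  pauli_reflection pauliP pauliZ pauliX al%:C be%:C.

Lemma reflection_adj al be : (reflection al be)^t* = reflection al be.
Proof.
have aE k l : (delta_mx k l : 'M[C]_d)^t* = delta_mx l k.
  by rewrite trmx_delta map_delta_mx.
have aP : pauliP^t* = pauliP by rewrite adjD !aE.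
have aZ : pauliZ^t* = pauliZ by rewrite adjB !aE.
have aX : pauliX^t* = pauliX by rewrite adjD !aE addrC.
rewrite /reflection /pauli_reflection; move: aP aZ aX.
move: pauliP pauliZ pauliX => P Z X aP aZ aX.
by rewrite 2!adjD adjB adj1 !adjZ aP aZ aX !conj_real.
Qed.

Let deltaM (k l m n : 'I_d) : (delta_mx k l : 'M[C]_d) *m delta_mx m n =
    if l == m then delta_mx k n else 0.
Proof. by rewrite mul_delta_mx_cond; case: eqP. Qed.

Let ji : (j == i) = false. Proof. by rewrite eq_sym; apply: negbTE. Qed.
Let ijF : (i == j) = false. Proof. by apply: negbTE. Qed.
Local Ltac simp :=
  rewrite /pauliZ /pauliX /pauliP !(mulmxBl, mulmxBr, mulmxDl, mulmxDr, mulmxN, mulNmx) !deltaM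
    !eqxx ?ji ?ijF !(subr0, sub0r, addr0, add0r, opprK, oppr0).

Let ZZ : pauliZ *m pauliZ = pauliP. Proof. by simp. Qed.
Let XX : pauliX *m pauliX = pauliP. Proof. by simp; rewrite addrC. Qed.
Let PZ : pauliP *m pauliZ = pauliZ. Proof. by simp. Qed.
Let ZP : pauliZ *m pauliP = pauliZ. Proof. by simp. Qed.
Let PX : pauliP *m pauliX = pauliX. Proof. by simp; rewrite addrC. Qed.
Let XP : pauliX *m pauliP = pauliX. Proof. by simp; rewrite addrC. Qed.
Let ZX : pauliZ *m pauliX = delta_mx i j - delta_mx j i.
Proof. by simp. Qed.
Let XZ : pauliX *m pauliZ = - (pauliZ *m pauliX).
Proof. by rewrite ZX; simp; rewrite opprB addrC. Qed.

Let abC (al be : R) : al ^+ 2 + be ^+ 2 = 1 -> al%:C ^+ 2 + be%:C ^+ 2 = 1 :> C.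
Proof. by move=> ab; rewrite -!rmorphXn -rmorphD ab. Qed.

Lemma reflection_unitary al be : al ^+ 2 + be ^+ 2 = 1 ->
  reflection al be \is unitarymx.
Proof.
move=> /abC ab; apply/unitarymxP.
rewrite reflection_adj; exact: pauli_reflection_invol ZZ XX XZ PZ PX ZP XP _ _ ab.
Qed.

(** On the plane of [e_i] and [e_j] a diagonal matrix is its mean plus half the
    difference of its two entries times [Z]; only the latter part is moved. *)
Lemma reflection_realdiag al be e : al ^+ 2 + be ^+ 2 = 1 ->
  reflection al be *m realdiag e *m reflection al be = realdiag e +
    ((e 0 i - e 0 j) / 2)%:C *:
      ((- (2 * be ^+ 2))%:C *: pauliZ + (2 * al * be)%:C *: pauliX).
Proof.
move=> /abC ab.
have DE (k l : 'I_d) : realdiag e *m delta_mx k l = (e 0 k)%:C *: delta_mx k l.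
  apply/matrixP => m n; rewrite /realdiag mul_diag_mx !mxE.
  by case: (eqVneq m k) => [->//|_] /=; rewrite !mulr0.
have ED (k l : 'I_d) : delta_mx k l *m realdiag e = (e 0 l)%:C *: delta_mx k l.
  apply/matrixP => m n; rewrite /realdiag mul_mx_diag !mxE mulrC.
  by case: (eqVneq n l) => [->//|_] /=; rewrite andbF !mulr0.
set r : C := ((e 0 i - e 0 j) / 2)%:C.
have := pauli_reflection_conj ZZ XX XZ PZ PX ZP XP (r := r) (D := realdiag e) ab.
rewrite -/(reflection al be) => ->.
- by rewrite !(rmorphN, rmorphM, rmorphXn) rmorph_nat.
- by rewrite /pauliP mulmxDl mulmxDr !DE !ED.
- by rewrite /pauliZ mulmxBl mulmxBr !DE !ED.
rewrite ZX /pauliX mulmxDl mulmxDr !DE !ED /r rmorphM rmorphB fmorphV rmorph_nat.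
move: (delta_mx i j) (delta_mx j i) => z t.
by apply/matrixP => m n; rewrite !mxE; field.
Qed.

End Reflection.

(** * Eigenvalues are aligned *)

(** This exhibits a competitor obtained in an eigenbasis as a unitary conjugate of
    the original matrix, hence as a point of its orbit. *)
Lemma unitary_conj_conj (C : numClosedFieldType) n (W H D : 'M[C]_n) :
  W \is unitarymx -> W *m (H *m D *m H^t*) *m W^t* =
    (W *m H *m W^t*) *m (W *m D *m W^t*) *m (W *m H *m W^t*)^t*.
Proof. by move=> uW; rewrite !adjM trmxCK !mulmxA !mulmxKtV. Qed.

Lemma convex_split (F : comNzRingType) n (D Z X : 'M[F]_n) (u q t : F) :
  D + (u *: Z + (t * q + (1 - t) * - q) *: X) =
  t *: (D + (u *: Z + q *: X)) + (1 - t) *: (D + (u *: Z + - q *: X)).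
Proof. by apply/matrixP => k l; rewrite !mxE; ring. Qed.

(** In the plane of traceless real symmetric 2 x 2 matrices, [(u + r, q)] is a point
    strictly inside the circle of radius [r]; it lies on the vertical chord
    between the points of height [r (2 al be)] and its opposite on the circle.  The parameters [al]
    and [be] are the cosine and sine of half the angle of the upper end. *)
Lemma disk_point_between (R : rcfType) (r u q : R) :
  0 < r -> (u + r) ^+ 2 + q ^+ 2 < r ^+ 2 ->
  exists al be t : R, [/\ al ^+ 2 + be ^+ 2 = 1, r * - (2 * be ^+ 2) = u,
    0 < r * (2 * al * be), 0 < t < 1 &
    q = t * (r * (2 * al * be)) + (1 - t) * - (r * (2 * al * be))].
Proof.
move=> r0 disk; pose p := u + r; pose h := Num.sqrt (r ^+ 2 - p ^+ 2).
have q2 := sqr_ge0 q.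
have p2 : 0 < r ^+ 2 - p ^+ 2 by rewrite /p; lra.
have h0 : 0 < h by rewrite sqrtr_gt0.
have h2 : h ^+ 2 = r ^+ 2 - p ^+ 2 by rewrite sqr_sqrtr // ltW.
have rn : r != 0 by rewrite gt_eqF.
have hn : h != 0 by rewrite gt_eqF.
have sqr_lt (x y : R) : 0 < y -> x ^+ 2 < y ^+ 2 -> -1 < x / y < 1.
  move=> y0 xy; rewrite ltr_pdivlMr // ltr_pdivrMr // mulN1r mul1r -ltr_norml.
  by rewrite -(@ltr_pXn2r _ 2) ?nnegrE ?(ltW y0) // real_normK ?num_real.
have /andP[pr1 pr2] : -1 < p / r < 1 by apply: sqr_lt => //; lra.
have qh : -1 < q / h < 1 by apply: sqr_lt => //; rewrite h2 /p; lra.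
pose al := Num.sqrt ((1 + p / r) / 2); pose be := Num.sqrt ((1 - p / r) / 2).
have al2 : al ^+ 2 = (1 + p / r) / 2 by rewrite sqr_sqrtr //; lra.
have be2 : be ^+ 2 = (1 - p / r) / 2 by rewrite sqr_sqrtr //; lra.
have abh : r * (2 * al * be) = h.
  have x0 : 0 <= r * (2 * al * be).
    apply: mulr_ge0; first exact: ltW.
    by apply: mulr_ge0; [apply: mulr_ge0 => //|]; exact: sqrtr_ge0.
  apply/eqP; rewrite -(@eqrXn2 _ 2) ?(ltW h0) // !exprMn al2 be2 h2.
  by apply/eqP; field.
exists al, be, ((1 + q / h) / 2); rewrite abh; split=> //.
- by rewrite al2 be2; lra.
- by rewrite be2 /p; field.
- by case/andP: qh => ? ?; lra.
- by field.
Qed.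

Section Alignment.
Variables (R : realType) (d : nat) (N : 'M[R[i]]_d -> R).
Notation C := R[i].
Hypotheses (hN : is_norm N) (hui : unitarily_invariant N).
Hypothesis hsc : strictly_convex N.
Implicit Types (S G W U : 'M[C]_d) (a s g : 'rV[R]_d).

(** Moving a 2 x 2 block strictly inside the circle of its conjugates makes it a
    convex combination of two distinct such conjugates.  The coefficient [u]
    measures the displacement from [r Z], whence the centre [(- r, 0)] of the disk. *)
Lemma norm_disk_lt (i j : 'I_d) a (u q : R) : i != j ->
  let r := (a 0 i - a 0 j) / 2 in
  0 < r -> (u + r) ^+ 2 + q ^+ 2 < r ^+ 2 ->
  N (realdiag a + (u%:C *: pauliZ R i j + q%:C *: pauliX R i j)) < N (realdiag a).
Proof.
move=> ij r r0 /(disk_point_between r0) [al [be [t [ab ru h0 t01 ->]]]].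
set h := r * (2 * al * be) in h0 *.
have conjE (b x : R) : al ^+ 2 + b ^+ 2 = 1 -> r * - (2 * b ^+ 2) = u ->
    r * (2 * al * b) = x ->
    N (realdiag a + (u%:C *: pauliZ R i j + x%:C *: pauliX R i j)) = N (realdiag a).
  move=> ab' rbu rbx.
  rewrite -[RHS](norm_conj hui (realdiag a) (reflection_unitary ij ab')).
  congr N; symmetry; rewrite reflection_adj reflection_realdiag // scalerDr.
  by rewrite !scalerA -!rmorphM rbu rbx.
have n1 := conjE be h ab ru erefl.
have n2 : N (realdiag a + (u%:C *: pauliZ R i j + (- h)%:C *: pauliX R i j)) =
    N (realdiag a).
  by apply: (conjE (- be)); rewrite ?sqrrN // !mulrN.
have Xij : pauliX R i j i j = 1.
  by rewrite !mxE !eqxx [j == i]eq_sym (negbTE ij) addr0.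
clearbody h; move: (pauliZ R i j) (pauliX R i j) Xij n1 n2 => Z X Xij n1 n2.
have -> : (t * h + (1 - t) * - h)%:C = t%:C * h%:C + (1 - t%:C) * - h%:C :> C.
  by rewrite rmorphD !rmorphM rmorphN rmorphB rmorph1.
rewrite convex_split -n1.
have tC : 1 - t%:C = (1 - t)%:C :> C by rewrite rmorphB rmorph1.
have hC : - h%:C = (- h)%:C :> C by rewrite rmorphN.
rewrite tC hC.
refine (strict_convexity hN hsc (etrans n1 (esym n2)) _ t01).
move=> /addrI/addrI/matrixP/(_ i j); rewrite [LHS]mxE [RHS]mxE Xij !mulr1.
move=> /complexI hh; suff : h < h by rewrite ltxx.
by rewrite {1}hh (lt_trans _ h0) // oppr_lt0.
Qed.

(** An inversion is undone by slightly turning the eigenbasis of [G]: with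
    [w] and [rho] the half-gaps of [s] and of [- g], the square radius of the block
    of [S - G] decreases from [(w + rho)^2] by [4 rho w be^2], where [be] is the
    sine of half the angle by which the block of [G] turns in the plane of [Z] and
    [X]. *)
Lemma aligned_eigenvalues mu W s g : W \is unitarymx ->
  local_minimizer (orbit_of mu)
    (fun G => N (W *m realdiag s *m W^t* - G)) (W *m realdiag g *m W^t*) ->
  forall i j, s 0 j < s 0 i -> g 0 j <= g 0 i.
Proof.
move=> uW [oG [e e0 minG]] i j sij; rewrite leNgt; apply/negP => gij.
have ij : i != j by apply: contraTneq sij => ->; rewrite ltxx.
have [rho rhoE] : exists rho, rho = (g 0 j - g 0 i) / 2 by exists ((g 0 j - g 0 i) / 2).
have rho0 : 0 < rho by rewrite rhoE; lra.
set Z := pauliZ R i j; set X := pauliX R i j.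
pose c := entry_norm W * (rho * (2 * entry_norm Z + 2 * entry_norm X)) * entry_norm W.
have c0 : 0 <= c by rewrite /c; do ![apply: mulr_ge0 | apply: addr_ge0
    | exact: entry_norm_ge0 | exact: ltW].
(* The displacement of the competitor is at most [be * c]. *)
pose be := Num.min (1 / 2) (e / 2 / (c + 1)).
have c1 : 0 < c + 1 by lra.
have be0 : 0 < be by rewrite lt_min !divr_gt0.
have be1 : be <= 1 / 2 by rewrite ge_min lexx.
have bec : be * c < e.
  have : be * (c + 1) <= e / 2 by rewrite -ler_pdivlMr // ge_min lexx orbT.
  lra.
pose al := Num.sqrt (1 - be ^+ 2).
have b2 : be ^+ 2 <= be by rewrite expr2 ler_piMr //; lra.
have al2 : al ^+ 2 = 1 - be ^+ 2 by rewrite sqr_sqrtr //; lra.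
have al0 : 0 <= al by exact: sqrtr_ge0.
have al1 : al <= 1.
  rewrite -(@ler_pXn2r _ 2) ?nnegrE // expr1n al2; have := sqr_ge0 be; lra.
have ab1 : al ^+ 2 + be ^+ 2 = 1 by rewrite al2 subrK.
pose T : 'M[C]_d := (- (2 * be ^+ 2))%:C *: Z + (2 * al * be)%:C *: X.
have [H uH HG] : exists2 H : 'M[C]_d, H \is unitarymx &
    H *m realdiag g *m H^t* = realdiag g - rho%:C *: T.
  exists (reflection i j al be); first exact: reflection_unitary.
  rewrite reflection_adj reflection_realdiag // -scaleNr -rmorphN.
  by congr (_ + _%:C *: _); rewrite rhoE; field.
have nT : entry_norm T <= be * (2 * entry_norm Z + 2 * entry_norm X).
  have z0 := entry_norm_ge0 Z; have x0 := entry_norm_ge0 X.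
  rewrite (le_trans (entry_normD _ _)) // !entry_normZ !normc_real normrN.
  rewrite !ger0_norm; last 2 first.
  - by rewrite mulr_ge0 ?(ltW be0) // mulr_ge0.
  - by rewrite mulr_ge0 ?sqr_ge0.
  have h1 := ler_wpM2r z0 b2.
  have h2 : al * (be * entry_norm X) <= be * entry_norm X.
    by rewrite ler_piMl // mulr_ge0 // ltW.
  lra.
have TE : T = (- (2 * be ^+ 2))%:C *: Z + (2 * al * be)%:C *: X by [].
clearbody T.
have uWH := mul_unitarymx uW uH.
have oG' : orbit_of mu (W *m (H *m realdiag g *m H^t*) *m W^t*).
  have -> : W *m (H *m realdiag g *m H^t*) *m W^t* =
      (W *m H *m W^t*) *m (W *m realdiag g *m W^t*) *m (W *m H *m W^t*)^t*.
    exact: (unitary_conj_conj H (realdiag g) uW).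
  exact: (orbit_conj (mul_unitarymx uWH (adj_unitary uW)) oG).
have /(minG _ oG') : spectral_norm (W *m (H *m realdiag g *m H^t*) *m W^t* - W *m realdiag g *m W^t*) < e.
  apply: (le_lt_trans _ bec); rewrite (le_trans (spectral_norm_le _)) //.
  rewrite -mulmxBl -mulmxBr HG addrC addKr.
  rewrite (le_trans (entry_norm_sandwich _ _ _)) // entry_norm_adj entry_normN.
  rewrite entry_normZ normc_real ger0_norm ?(ltW rho0) //.
  have -> : be * c = entry_norm W *
      (rho * (be * (2 * entry_norm Z + 2 * entry_norm X))) * entry_norm W.
    by rewrite /c; ring.
  by rewrite ler_wpM2r ?entry_norm_ge0 // ler_wpM2l ?entry_norm_ge0 // ler_wpM2l // ltW.
apply/negP; rewrite -ltNge -!mulmxBl -!mulmxBr !norm_conj //.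
rewrite HG opprB addrA addrAC -realdiagB TE scalerDr !scalerA -!rmorphM.
have r0 : 0 < ((s - g) 0 i - (s - g) 0 j) / 2 by rewrite !mxE; lra.
apply: norm_disk_lt => //; rewrite !mxE.
have -> : (rho * (2 * al * be)) ^+ 2 = 4 * rho ^+ 2 * (1 - be ^+ 2) * be ^+ 2.
  by rewrite -al2; ring.
set x := (s 0 i - g 0 i - _) / 2.
have -> : x = (s 0 i - s 0 j) / 2 + rho by rewrite /x rhoE; field.
pose w := (s 0 i - s 0 j) / 2; rewrite -/w.
have w0 : 0 < w by rewrite /w; lra.
rewrite -subr_gt0.
have -> : (w + rho) ^+ 2 - ((rho * - (2 * be ^+ 2) + (w + rho)) ^+ 2 +
   4 * rho ^+ 2 * (1 - be ^+ 2) * be ^+ 2) = 4 * rho * w * be ^+ 2 by ring.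
apply: mulr_gt0; last exact: exprn_gt0.
by apply: mulr_gt0 => //; apply: mulr_gt0.
Qed.

End Alignment.

(** * Compactness of the unitary orbit *)

Section Compactness.
Import functions topology normedtype realfun derive.
Import numFieldNormedType.Exports.

Section ContinuousEntries.
Variables (R : realType) (T : topologicalType).
Notation C := R[i].
Implicit Types f g : T -> C.

(** Only the topology of the reals is used: the unitary group is parametrised by real
    coordinates, for which closed boxes are compact. *)
Definition continuousC f :=
  continuous (fun t => complex.Re (f t)) /\ continuous (fun t => complex.Im (f t)).

Definition continuous_mx m n (F : T -> 'M[C]_(m, n)) :=
  forall i j, continuousC (fun t => F t i j).

Lemma continuousC_ext f g : f =1 g -> continuousC f -> continuousC g.
Proof. by move=> /funext ->. Qed.

Lemma continuousC_cst c : continuousC (fun _ : T => c).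
Proof. by split=> t; exact: cvg_cst. Qed.

Lemma continuousR_ext (u v : T -> R) : u =1 v -> continuous u -> continuous v.
Proof. by move=> /funext ->. Qed.

Lemma continuousC_add f g : continuousC f -> continuousC g ->
  continuousC (fun t => f t + g t).
Proof.
move=> [fr fi] [gr gi]; split.
  apply: continuousR_ext (fun t => continuousD (fr t) (gr t)) => t.
  by rewrite !fctE; case: (f t) => ? ?; case: (g t).
apply: continuousR_ext (fun t => continuousD (fi t) (gi t)) => t.
by rewrite !fctE; case: (f t) => ? ?; case: (g t).
Qed.

Lemma continuousC_mul f g : continuousC f -> continuousC g ->
  continuousC (fun t => f t * g t).
Proof.
move=> [fr fi] [gr gi]; split.
  apply: (@continuousR_ext (fun t => complex.Re (f t) * complex.Re (g t) -
      complex.Im (f t) * complex.Im (g t))) => t.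
    by case: (f t) => ? ?; case: (g t).
  exact: (continuousB (continuousM (fr t) (gr t)) (continuousM (fi t) (gi t))).
apply: (@continuousR_ext (fun t => complex.Re (f t) * complex.Im (g t) +
    complex.Im (f t) * complex.Re (g t))) => t.
  by case: (f t) => ? ?; case: (g t).
exact: (continuousD (continuousM (fr t) (gi t)) (continuousM (fi t) (gr t))).
Qed.

Lemma continuousC_conj f : continuousC f -> continuousC (fun t => Num.conj (f t)).
Proof.
move=> [fr fi]; split.
  by apply: continuousR_ext fr => t; case: (f t).
apply: continuousR_ext (fun t => continuousN (fi t)) => t.
by case: (f t).
Qed.

Lemma continuousC_sum (I : finType) (F : I -> T -> C) :
  (forall i, continuousC (F i)) -> continuousC (fun t => \sum_i F i t).
Proof.
move=> cF; rewrite unlock; elim: (index_enum I) => [|i s IH] /=.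
  exact: continuousC_cst.
exact: continuousC_add.
Qed.

Lemma continuous_mx_cst m n (A : 'M[C]_(m, n)) : continuous_mx (fun=> A).
Proof. by move=> i j; exact: continuousC_cst. Qed.

Lemma continuous_mxM m n p (F : T -> 'M[C]_(m, n)) (G : T -> 'M[C]_(n, p)) :
  continuous_mx F -> continuous_mx G -> continuous_mx (fun t => F t *m G t).
Proof.
move=> cF cG i j.
apply: (@continuousC_ext (fun t => \sum_k F t i k * G t k j)).
  by move=> t; rewrite mxE.
by apply: continuousC_sum => k; apply: continuousC_mul.
Qed.

Lemma continuous_mx_adj m n (F : T -> 'M[C]_(m, n)) :
  continuous_mx F -> continuous_mx (fun t => (F t)^t*).
Proof.
move=> cF i j; apply: (@continuousC_ext (fun t => Num.conj (F t j i))).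
  by move=> t; rewrite !mxE.
exact: continuousC_conj.
Qed.

Lemma continuous_mxB m n (F G : T -> 'M[C]_(m, n)) :
  continuous_mx F -> continuous_mx G -> continuous_mx (fun t => F t - G t).
Proof.
move=> cF cG i j; apply: (@continuousC_ext (fun t => F t i j + (-1) * G t i j)).
  by move=> t; rewrite !mxE mulN1r.
by apply: continuousC_add => //; apply: continuousC_mul => //; apply: continuousC_cst.
Qed.

Lemma continuous_sumR (I : finType) (F : I -> T -> R) :
  (forall i, continuous (F i)) -> continuous (fun t => \sum_i F i t).
Proof.
move=> cF; rewrite unlock; elim: (index_enum I) => [|i s IH] /=.
  by move=> t; exact: cvg_cst.
by move=> t; exact: (continuousD (cF i t) (IH t)).
Qed.

Lemma continuous_entry_norm m n (F : T -> 'M[C]_(m, n)) :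
  continuous_mx F -> continuous (fun t => entry_norm (F t)).
Proof.
move=> cF; apply: continuous_sumR => i; apply: continuous_sumR => j.
have [cr ci] := cF i j; apply: (@continuousR_ext (fun t => Num.sqrt
    (complex.Re (F t i j) * complex.Re (F t i j) +
     complex.Im (F t i j) * complex.Im (F t i j)))).
  by move=> t; case: (F t i j) => x y; rewrite /= !expr2.
move=> t; apply: continuous_comp; last exact: sqrt_continuous.
exact: continuousD (continuousM (cr t) (cr t)) (continuousM (ci t) (ci t)).
Qed.

(** Any norm is Lipschitz for the entry norm, by the triangle inequality. *)
Lemma continuous_norm d (N : 'M[C]_d -> R) (F : T -> 'M[C]_d) :
  is_norm N -> continuous_mx F -> continuous (fun t => N (F t)).
Proof.
move=> hN cF t0; have [K K0 NK] := norm_le_entry_norm hN.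
have K1 : 0 < K + 1 by rewrite ltr_wpDl.
have := continuous_entry_norm (continuous_mxB cF (continuous_mx_cst (F t0))) (x := t0).
move=> h; apply/cvgrPdist_lt => e e0.
have /cvgrPdist_lt/(_ (e / (K + 1))) := h.
rewrite divr_gt0 // => /(_ isT); apply: filterS => t.
have -> : entry_norm (F t0 - F t0) = 0.
  by rewrite subrr -(scale0r 0) entry_normZ normc0 mul0r.
rewrite sub0r normrN ger0_norm ?entry_norm_ge0 // ltr_pdivlMr // => lt.
have tri A B : `|N A - N B| <= N (A - B).
  have AB := norm_triangle hN (A - B) B; have BA := norm_triangle hN (B - A) A.
  rewrite !subrK in AB BA.
  have NN : N (B - A) = N (A - B).
    by rewrite -opprB -scaleN1r (normZ hN) normcN normc1 mul1r.
  rewrite ler_norml; apply/andP; split; lra.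
apply: le_lt_trans lt; rewrite distrC (le_trans (tri _ _)) // (le_trans (NK _)) //.
rewrite mulrC ler_wpM2l ?entry_norm_ge0 //; lra.
Qed.

End ContinuousEntries.

Section OrbitMinimizer.
Variables (R : realType) (d : nat) (N : 'M[R[i]]_d -> R).
Notation C := R[i].
Hypotheses (hN : is_norm N).
Implicit Types (S G W U : 'M[C]_d) (mu : 'rV[R]_d).

Definition coords_mx (p : 'rV[R]_(d * d + d * d)) : 'M[C]_d :=
  \matrix_(i, j) (p 0 (lshift (d * d) (mxvec_index i j)) +i*
                  p 0 (rshift (d * d) (mxvec_index i j))).

Definition mx_coords U : 'rV[R]_(d * d + d * d) :=
  row_mx (mxvec (map_mx (@complex.Re R) U)) (mxvec (map_mx (@complex.Im R) U)).

Lemma mx_coordsK : cancel mx_coords coords_mx.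
Proof.
move=> U; apply/matrixP => i j; rewrite mxE row_mxEl row_mxEr !mxvecE !mxE.
by case: (U i j).
Qed.

Lemma continuous_coords_mx : continuous_mx coords_mx.
Proof.
move=> i j; split.
  by apply: continuousR_ext (@coord_continuous R _ _ 0 _) => p; rewrite mxE.
by apply: continuousR_ext (@coord_continuous R _ _ 0 _) => p; rewrite mxE.
Qed.

Definition unitary_coords : set 'rV[R]_(d * d + d * d) :=
  [set p | coords_mx p \is unitarymx].

(** The unitary group is closed, being defined by a continuous equation, and it is
    bounded, since the rows of a unitary matrix are unit vectors. *)
Lemma compact_unitary_coords : compact unitary_coords.
Proof.
apply: (@subclosed_compact _ _
  [set p : 'rV[R]_(d * d + d * d) | forall i, `[(-1 : R), 1]%classic (p ord0 i)]).
- have -> : unitary_coords =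
      (fun p => entry_norm (coords_mx p *m (coords_mx p)^t* - 1%:M)) @^-1` [set 0].
    apply/seteqP; split=> p /=; first by move=> /unitarymxP ->; rewrite subrr entry_norm0.
    by move=> /entry_norm_eq0 /subr0_eq /unitarymxP.
  apply: preimage_closed; last exact: closed_eq.
  move=> p _; apply: continuous_entry_norm.
  apply: continuous_mxB; last exact: continuous_mx_cst.
  apply: continuous_mxM; first exact: continuous_coords_mx.
  exact: continuous_mx_adj continuous_coords_mx.
- by apply: (rV_compact (A := fun=> `[(-1 : R), 1]%classic)) => i; exact: segment_compact.
- move=> p up k; rewrite /= in_itv /= -ler_norml.
  have := fun i j => unitary_entry_le1 i j up.
  have normRI (z : C) : `|complex.Re z| <= normc z /\ `|complex.Im z| <= normc z.
    case: z => x y; rewrite -!sqrtr_sqr !ler_wsqrtr ?lerDl ?lerDr ?sqr_ge0 //.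
  case: (split_ordP k) => k' ->; case/mxvec_indexP: k' => i j /(_ i j).
    by apply: le_trans; have [+ _] := normRI (coords_mx p i j); rewrite mxE.
  by apply: le_trans; have [_] := normRI (coords_mx p i j); rewrite mxE.
Qed.

(** The minimum of a continuous function on the unitary group, as the orbit is the
    conjugacy class of any of its points. *)
Lemma orbit_minimizer mu S G0 : orbit_of mu G0 ->
  exists G1, global_minimizer (orbit_of mu) (fun G => N (S - G)) G1.
Proof.
move=> oG0; have [hG0 lG0] := oG0; have [W uW G0E] := hermitian_diag hG0.
have orbE G : orbit_of mu G ->
    exists2 U : 'M[C]_d, U \is unitarymx & G = U *m G0 *m U^t*.
  move=> [hG lG]; have [V uV GE] := hermitian_diag hG.
  exists (V *m W^t*); first exact: mul_unitarymx uV (adj_unitary uW).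
  rewrite lG in GE; rewrite lG0 in G0E.
  by rewrite [LHS]GE [in RHS]G0E; exact: unitary_transport.
pose f p := N (S - coords_mx p *m G0 *m (coords_mx p)^t*).
have cf : continuous f.
  apply: (continuous_norm hN); apply: continuous_mxB; first exact: continuous_mx_cst.
  apply: continuous_mxM; last exact: continuous_mx_adj continuous_coords_mx.
  by apply: continuous_mxM; [exact: continuous_coords_mx|exact: continuous_mx_cst].
have [|p pU pmin] := compact_EVT_min _ compact_unitary_coords (continuous_subspaceT cf).
  exists (mx_coords 1%:M); rewrite /unitary_coords /= mx_coordsK.
  by apply/unitarymxP; rewrite adj1 mulmx1.
exists (coords_mx p *m G0 *m (coords_mx p)^t*); split.
  have uP : coords_mx p \is unitarymx by move: pU; rewrite inE.
  exact: orbit_conj uP oG0.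
move=> G /orbE[U uU ->]; have := pmin (mx_coords U).
by rewrite /f mx_coordsK; apply; rewrite inE /unitary_coords /= mx_coordsK.
Qed.

End OrbitMinimizer.

End Compactness.

(** * Structure of minimizers *)

Section Main.
Variables (R : realType) (d : nat).
Notation C := R[i].
Implicit Types (S G W U V : 'M[C]_d) (mu x : 'rV[R]_d).

Lemma unitary_cols_basis V : V \is unitarymx ->
  orthonormal_basis (fun i => col i V).
Proof.
move=> uV; split.
  move=> i j; have /matrixP/(_ j i) := unitarymxPr uV; rewrite !mxE eq_sym => <-.
  by apply: eq_bigr => k _; rewrite !mxE mulrC.
rewrite basisEdim size_map -cardE card_ord dimvf dim_matrix.
have -> : (d * 1%N)%R = d by exact: muln1.
rewrite leqnn andbT.
apply/subvP => x _.
have -> : x = \sum_k (V^t* *m x) k 0 *: col k V.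
  rewrite -[LHS]mul1mx -(unitarymxP uV) -mulmxA; apply/matrixP => a b.
  rewrite (ord1 b) summxE mxE; apply: eq_bigr => k _.
  by rewrite [RHS]mxE [col k V a 0]mxE mulrC.
apply: memv_suml => k _; apply/memvZ/memv_span/map_f; exact: mem_enum.
Qed.

Lemma unitary_diag_rank1 V x :
  V *m realdiag x *m V^t* = \sum_i (x 0 i)%:C *: rank1 (col i V) (col i V).
Proof.
apply/matrixP => a b; rewrite summxE mxE; apply: eq_bigr => k _.
have rE : rank1 (col k V) (col k V) a b = V a k * (V^t*) k b.
  by rewrite /rank1 mxE big_ord1 !mxE.
rewrite /realdiag mul_mx_diag [RHS]mxE rE mulrA [_%:C * _]mulrC.
by congr (_ * _); rewrite !mxE.
Qed.

(** Shared by the given local minimizer and by the global minimizer to which it is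
    compared. *)
Lemma local_minimizer_structure mu N S G : is_norm N -> unitarily_invariant N ->
  strictly_convex N -> S \is hermsymmx ->
  local_minimizer (orbit_of mu) (fun G => N (S - G)) G ->
  exists2 V : 'M[C]_d, V \is unitarymx &
    S = V *m realdiag (lambda S) *m V^t* /\ G = V *m realdiag mu *m V^t*.
Proof.
move=> hN hui hsc hS minG; have [[hG lG] _] := minG.
have com := hermitian_commute hN hui hsc hS minG.
have [W uW [s [g [SE GE]]]] := codiagonalize hS hG com.
have al : forall i j, s 0 j < s 0 i -> g 0 j <= g 0 i.
  by apply: (aligned_eigenvalues hN hui hsc (mu := mu) uW); rewrite -SE -GE.
have [V uV [SV GV]] := sorted_codiag uW al.
have lS : lambda S = rearr s by rewrite SE lambda_unitary_diag.
have lG' : mu = rearr g by rewrite -lG GE lambda_unitary_diag.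
by exists V => //; rewrite lS lG' {1}SE {1}GE.
Qed.

End Main.

Theorem theorem3p5 (R : realType) (d : nat) (S : 'M[R[i]]_d) (mu : 'rV[R]_d)
    (N : 'M[R[i]]_d -> R) (G0 : 'M[R[i]]_d)
    (hS : S \is hermsymmx)
    (hmu : decreasing_vectors mu)
    (hN : is_norm N)
    (hui : unitarily_invariant N)
    (hsc : strictly_convex N)
    (hG0 : local_minimizer (orbit_of mu) (fun G => N (S - G)) G0) :
  (exists v : 'I_d -> 'cV[R[i]]_d,
    [/\ orthonormal_basis v,
        S = \sum_(i < d) (lambda S 0 i)%:C *: rank1 (v i) (v i) &
        G0 = \sum_(i < d) (mu 0 i)%:C *: rank1 (v i) (v i)]) /\
  lambda (S - G0) = rearr (lambda S - lambda G0) /\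
  global_minimizer (orbit_of mu) (fun G => N (S - G)) G0.
Proof.
have [[hG lG] _] := hG0.
have [V uV [SV GV]] := local_minimizer_structure hN hui hsc hS hG0.
have SG V' : V' *m realdiag (lambda S) *m V'^t* - V' *m realdiag mu *m V'^t* =
    V' *m realdiag (lambda S - mu) *m V'^t*.
  by rewrite -mulmxBl -mulmxBr -realdiagB.
split.
  exists (fun i => col i V); split; first exact: unitary_cols_basis.
    by rewrite -unitary_diag_rank1.
  by rewrite -unitary_diag_rank1.
split; first by rewrite {1}SV {1}GV SG lambda_unitary_diag // lG.
split=> // G oG.
have val V' G' : V' \is unitarymx -> S = V' *m realdiag (lambda S) *m V'^t* ->
    G' = V' *m realdiag mu *m V'^t* -> N (S - G') = N (realdiag (lambda S - mu)).
  by move=> uV' SV' ->; rewrite {1}SV' SG; exact: norm_conj.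
have [G1 [oG1 minG1]] := orbit_minimizer hN S oG.
(* A global minimizer is local with any radius; having the same structure as [G0],
   it has the same distance to [S]. *)
have loc1 : local_minimizer (orbit_of mu) (fun G => N (S - G)) G1.
  by split=> //; exists 1 => // G' oG' _; exact: minG1.
have [V1 uV1 [SV1 GV1]] := local_minimizer_structure hN hui hsc hS loc1.
by rewrite (val _ _ uV SV GV) -(val _ _ uV1 SV1 GV1); exact: minG1.
Qed.
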